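(* If $p(z)$ is a self-interlacing polynomial, then the polynomial $$\Delta_{0,h}p(z)=\frac{p(z+ih)-p(z-ih)}{2ih}$$ is also self-interlacing for any $h>0$.
   Context: A real polynomial $p(z)$ is called self-interlacing if it has real and simple roots, and the roots of $p(z)$ strictly interlace the roots of $p(-z)$. *)

(* Defs.v *)
From HB Require Import structures.
From mathcomp Require Import all_boot all_order all_algebra.
From mathcomp Require Import complex.
From mathcomp Require Import reals.

Set Implicit Arguments.
Unset Strict Implicit.
Unset Printing Implicit Defensive.

Import Order.TTheory GRing.Theory Num.Theory.

Local Open Scope ring_scope.
Local Open Scope complex_scope.

Definition toCpoly (R : realType) (p : {poly R}) : {poly R[i]} :=
  map_poly (real_complex R) p.

(* Nonzero constants satisfy this vacuously; the zero polynomial does not,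
   since every complex number is one of its roots. *)
Definition real_simple_roots (R : realType) (p : {poly R}) : Prop :=
  forall z : R[i], root (toCpoly p) z ->
    (exists x : R, z = x%:C) /\ mup z (toCpoly p) = 1%N.

Definition consecutive_roots (R : realType) (p : {poly R}) (a b : R) : Prop :=
  [/\ a < b, root p a, root p b & forall c, a < c < b -> ~~ root p c].

(* Meant for polynomials all of whose roots are real and simple. *)
Definition strictly_interlace (R : realType) (p q : {poly R}) : Prop :=
  [/\ forall x, root p x -> ~~ root q x,
      forall a b, consecutive_roots p a b ->
        exists! c, a < c < b /\ root q c
    & forall a b, consecutive_roots q a b ->
        exists! c, a < c < b /\ root p c].

Definition self_interlacing (R : realType) (p : {poly R}) : Prop :=
  real_simple_roots p /\ strictly_interlace p (p \Po (- 'X)).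

Definition Delta0 (R : realType) (h : R) (p : {poly R}) : {poly R[i]} :=
  (2 * 'i * h%:C)^-1 *:
    ((toCpoly p \Po ('X + ('i * h%:C)%:P))
     - (toCpoly p \Po ('X - ('i * h%:C)%:P))).

(* Main.v *)
(* Put g = p + i s p(-X).  Strict interlacing makes all residues of p(-X) / p
   have the same sign, so for a suitable s = 1 or s = -1 every root of g lies in
   the open upper half-plane (Hermite-Biehler).  If Im z <= 0, then z + ih is
   closer than z - ih to every root of g, hence |g(z + ih)| < |g(z - ih)| and
   Delta g(z) <> 0.  Now q = Delta p satisfies q - i s q(-X) = Delta g, and the
   converse half of Hermite-Biehler applies: comparing moduli at z and conj z
   shows that the roots of q are real, and Im (f' / f) > 0 on the real line, for
   f = q - i s q(-X), shows that the Wronskian of q and q(-X) has no real zero,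
   which gives simplicity and interlacing. *)
Require Import Defs.
From HB Require Import structures.
From mathcomp Require Import all_boot all_order all_algebra.
From mathcomp Require Import complex polyrcf ring lra.
From mathcomp Require Import reals.

Import Order.TTheory GRing.Theory Num.Theory.

Local Open Scope ring_scope.

Set Implicit Arguments.
Unset Strict Implicit.

(** * Simple roots and linear factors *)

Lemma simple_rootE (F : fieldType) (p : {poly F}) (x : F) :
  p != 0 -> root p x -> (mup x p == 1%N) = (p^`().[x] != 0).
Proof.
move=> p0 /factor_theorem[u pE]; rewrite pE in p0 *.
have [u0 X0] : u != 0 /\ 'X - x%:P != 0.
  by apply/andP; rewrite -negb_or -mulf_eq0.
rewrite mupM // -['X - _]expr1 mup_XsubCX eqxx addn1 eqSS expr1.
rewrite derivM derivXsubC !hornerE subrr mulr0 add0r.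
by rewrite eqn0Ngt -XsubC_dvd // dvdp_XsubCl rootE.
Qed.

Lemma factor_two_roots (F : fieldType) (p : {poly F}) (c d : F) :
  c != d -> root p c -> root p d ->
  exists u, p = u * ('X - d%:P) * ('X - c%:P).
Proof.
move=> cd /factor_theorem[v ->]; rewrite rootM root_XsubC eq_sym (negPf cd) orbF.
by case/factor_theorem=> u ->; exists u.
Qed.

(** * The Wronskian and interlacing *)

Definition wronskian (F : nzRingType) (a b : {poly F}) := a^`() * b - a * b^`().

Lemma wronskianC (F : comNzRingType) (a b : {poly F}) :
  wronskian b a = - wronskian a b.
Proof. by rewrite /wronskian; ring. Qed.

(* Writing a = (X - c)(X - d) u, the Wronskian equals (c - d) u b at c and
   (d - c) u b at d, so u b changes sign between c and d. *)
Lemma root_between (R : realType) (a b : {poly R}) (c d : R) :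
  (forall x y, 0 < (wronskian a b).[x] * (wronskian a b).[y]) ->
  consecutive_roots a c d -> exists2 e, c < e < d & root b e.
Proof.
move=> W [cd ac ad nr]; have := W c d.
have cNd : c != d by rewrite lt_eqF.
have sq_gt0 : 0 < (c - d) ^+ 2 by rewrite exprn_even_gt0 //= subr_eq0.
have [u aE] := factor_two_roots cNd ac ad.
rewrite /wronskian aE !derivM !derivXsubC !hornerE => Wcd.
have ub : (u * b).[c] * (u * b).[d] < 0.
  have -> : (u * b).[c] * (u * b).[d] = u.[c] * b.[c] * (u.[d] * b.[d]).
    by rewrite !hornerE.
  rewrite -(pmulr_llt0 _ sq_gt0) -oppr_gt0; apply: (lt_le_trans Wcd).
  by rewrite le_eqVlt; apply/orP; left; apply/eqP; ring.
have [e] := poly_ivtoo (ltW cd) ub.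
rewrite in_itv /= rootM => ecd /orP[ue|be]; last by exists e.
by have := nr e ecd; rewrite aE !rootM ue.
Qed.

Lemma next_consecutive_root (R : realType) (p : {poly R}) (x y : R) :
  p != 0 -> x < y -> root p x -> root p y ->
  exists2 z, consecutive_roots p x z & z <= y.
Proof.
move=> p0 xy px py; case: (next_rootP p x y) => [p00|z _ pz|_ _ _].
- by rewrite p00 eqxx in p0.
- rewrite in_itv /= => /andP[xz zy] nr; exists z; [|exact: ltW].
  by split=> //; exact/eqP.
- by move=> nr; exists y.
Qed.

(** Two roots of [b] between [c] and [d] would enclose a root of [a], because the hypothesis
    survives the exchange of [a] and [b]; but [c] and [d] are consecutive. *)
Lemma unique_root_between (R : realType) (a b : {poly R}) (c d : R) :
  (forall x y, 0 < (wronskian a b).[x] * (wronskian a b).[y]) ->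
  consecutive_roots a c d -> exists! e, c < e < d /\ root b e.
Proof.
move=> W cd; have [e ecd be] := root_between W cd.
have b0 : b != 0.
  apply/eqP => b0; have := W 0 0.
  by rewrite b0 /wronskian deriv0 !mulr0 subr0 !hornerE ltxx.
have [_ _ _ nr] := cd.
have noroot2 x y : c < x < d -> c < y < d -> root b x -> root b y -> ~ x < y.
  move=> /andP[cx _] /andP[_ yd] bx by_ xy.
  have [z xz zy] := next_consecutive_root b0 xy bx by_.
  have W' s t : 0 < (wronskian b a).[s] * (wronskian b a).[t].
    by rewrite wronskianC !hornerN mulrNN; exact: W.
  have [t /andP[xt tz] at0] := root_between W' xz.
  have ctd : c < t < d by rewrite (lt_trans cx) // (lt_trans (lt_le_trans tz zy)).
  by have /negP := nr t ctd.
exists e; split=> // f [fcd bf].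
case: (ltgtP e f) => // ef.
  by have [] := noroot2 e f ecd fcd be bf ef.
by have [] := noroot2 f e fcd ecd bf be ef.
Qed.

Lemma wronskian_interlace (R : realType) (a b : {poly R}) :
  (forall x y, 0 < (wronskian a b).[x] * (wronskian a b).[y]) ->
  strictly_interlace a b.
Proof.
move=> W; split=> [x ax|c d|c d]; last 2 first.
- exact: unique_root_between.
- by apply: unique_root_between => s t; rewrite wronskianC !hornerN mulrNN; exact: W.
apply/negP => /eqP bx; have := W x x.
by rewrite /wronskian !hornerE bx (eqP ax) !(mul0r,mulr0) subr0 mul0r ltxx.
Qed.

(** * Signs of the residues of q / p *)

Lemma consecutive_roots_ind (R : realType) (p : {poly R}) (r : R -> R -> Prop) :
  p != 0 -> (forall x y z, r x y -> r y z -> r x z) ->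
  (forall x y, consecutive_roots p x y -> r x y) ->
  forall x y, x < y -> root p x -> root p y -> r x y.
Proof.
move=> p0 rtr rc x y; move: {-1}(roots p x y) (erefl (roots p x y)) => s.
elim: s x => [|z s IH] x sE xy px py.
  by apply: rc; split=> // t txy; apply: (roots_nil p0 sE); rewrite in_itv.
move/eqP: sE; rewrite roots_cons => /and5P[_ + /eqP nr pz /eqP sE].
rewrite in_itv /= => /andP[xz zy].
apply: (rtr _ z); last exact: IH.
by apply: rc; split=> // t txy; apply: (roots_nil p0 nr); rewrite in_itv.
Qed.

Lemma prod_gt0_noroot (R : rcfType) (u : {poly R}) (c d : R) : c <= d ->
  (forall x, c <= x <= d -> ~~ root u x) -> 0 < u.[c] * u.[d].
Proof.
move=> cd nr; rewrite ltNge; apply/negP => /(polyrcf.poly_ivt cd)[x].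
by rewrite in_itv /= => /nr/negP.
Qed.

(** From [c] to [d] both [q] and the derivative of [p] reverse sign: the cofactor of the two roots
    in [p], and that of the only root of [q] in between, have no zero from [c] to [d]. The two
    reversals cancel in the quotient. *)
Lemma consecutive_residues (R : realType) (p q : {poly R}) (c d : R) :
  (forall x, root p x -> p^`().[x] != 0) ->
  (forall x, root q x -> q^`().[x] != 0) ->
  strictly_interlace p q -> consecutive_roots p c d ->
  0 < (q.[c] / p^`().[c]) * (q.[d] / p^`().[d]).
Proof.
move=> sp sq [npq pq _] cd; have [e [[ecd qe] ue]] := pq _ _ cd.
have [ltcd pc pd nr] := cd.
have cNd : c != d by rewrite lt_eqF.
have [u pE] := factor_two_roots cNd pc pd.
have [v qE] := factor_theorem _ _ qe.
have [ce ed] := andP ecd.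
have uP : 0 < u.[c] * u.[d].
  apply: prod_gt0_noroot; first exact: ltW.
  move=> x /andP[]; rewrite !le_eqVlt => /orP[/eqP<- _|cx /orP[/eqP->|xd]].
  - have := sp c pc; rewrite pE !derivM !derivXsubC !hornerE subrr.
    by rewrite mulr0 add0r mulf_eq0 negb_or => /andP[].
  - have := sp d pd; rewrite pE !derivM !derivXsubC !hornerE subrr.
    by rewrite !mulr0 !add0r addr0 mulf_eq0 negb_or => /andP[].
  - by have := nr x; rewrite cx xd pE !rootM !negb_or => /(_ isT)/andP[/andP[]].
have vP : 0 < v.[c] * v.[d].
  apply: prod_gt0_noroot; first exact: ltW.
  move=> x cxd; apply/negP => vx.
  have qx : root q x by rewrite qE rootM vx.
  move: cxd => /andP[]; rewrite !le_eqVlt => /orP[/eqP cx _|cx /orP[/eqP xd|xd]].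
  - by have := npq _ pc; rewrite cx qx.
  - by have := npq _ pd; rewrite -xd qx.
  (* A zero of [v] strictly inside would be the unique root [e], which would then be a double root
     of [q]. *)
  - have ex : e = x by apply: ue; rewrite cx.
    have := sq e qe; rewrite qE derivM derivXsubC !hornerE subrr mulr0 add0r.
    by rewrite ex (eqP vx) eqxx.
have pP : 0 < - (p^`().[c] * p^`().[d]).
  have -> : - (p^`().[c] * p^`().[d]) = u.[c] * u.[d] * (c - d) ^+ 2.
    by rewrite pE !derivM !derivXsubC !mulr1 !(hornerXsubC, hornerM, hornerD); ring.
  by rewrite mulr_gt0 // exprn_even_gt0 //= subr_eq0.
have qP : 0 < - (q.[c] * q.[d]).
  have -> : - (q.[c] * q.[d]) = v.[c] * v.[d] * ((e - c) * (d - e)).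
    by rewrite qE !(hornerXsubC, hornerM); ring.
  by rewrite mulr_gt0 // mulr_gt0 ?subr_gt0.
by rewrite mulrACA -invfM -mulrNN -invrN divr_gt0.
Qed.

(** * Partial fractions *)

Lemma size_divp_XsubC (F : fieldType) (p : {poly F}) (x : F) :
  size (p %/ ('X - x%:P)) = (size p).-1.
Proof. by rewrite size_divp ?polyXsubC_eq0 // size_XsubC subn1. Qed.

(** Lagrange interpolation: at a point of [s] only its own summand survives, and there
    [p %/ ('X - x%:P)] takes the value of the derivative of [p]. *)
Lemma partial_fractions (F : fieldType) (p q : {poly F}) (s : seq F) :
  uniq s -> size p = (size s).+1 -> all (root p) s -> (size q <= size p)%N ->
  exists k, q = k *: p
    + \sum_(x <- s) (q.[x] / p^`().[x]) *: (p %/ ('X - x%:P)).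
Proof.
(* This [k] cancels the coefficient of degree [size s], so the difference of the two sides has
   degree below [size s] but vanishes on all of [s]. *)
move=> us sp rs sq; exists (q`_(size s) / p`_(size s)).
have p0 : p != 0 by rewrite -size_poly_eq0 sp.
have lc0 : p`_(size s) != 0 by have := lead_coef_eq0 p; rewrite /lead_coef sp /= => ->.
apply/eqP; rewrite -subr_eq0 opprD addrA; apply/eqP.
have fE x : x \in s -> p = p %/ ('X - x%:P) * ('X - x%:P).
  by move=> /(allP rs); rewrite -dvdp_XsubCl => /divpK.
apply: (roots_geq_poly_eq0 _ us).
  apply/allP => x xs; rewrite rootE !hornerE (eqP (allP rs _ xs)) mulr0 subr0.
  rewrite horner_sum (bigD1_seq x) //= big1_seq ?addr0 => [|y /andP[yx ys]].
    have d0 : (p %/ ('X - x%:P)).[x] = p^`().[x].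
      by rewrite [in RHS](fE x xs) derivM derivXsubC !hornerE subrr mulr0 add0r.
    rewrite !hornerE d0 divfK ?subrr //.
    (* [p] is a constant multiple of the product over the duplicate-free [s], so its derivative is
       nonzero at [x]. *)
    have := all_roots_prod_XsubC sp rs; rewrite uniq_rootsE => /(_ us) pE.
    rewrite -simple_rootE // ?(allP rs) // pE -mul_polyC mupMr.
      by rewrite mu_prod_XsubC count_uniq_mem ?xs.
    by rewrite rootC lead_coef_eq0.
  have := allP rs _ xs; rewrite {1}(fE y ys) rootM root_XsubC eq_sym (negPf yx) orbF.
  by rewrite !hornerE => /eqP->; rewrite mulr0.
have small (u : {poly F}) : (size u <= (size s).+1)%N ->
    u`_(size s) = 0 -> (size u <= size s)%N.
  move=> su u0; apply/leq_sizeP => j; rewrite leq_eqVlt => /orP[/eqP<- //|sj].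
  by rewrite nth_default // (leq_trans su).
rewrite (leq_trans (size_polyD _ _)) // size_polyN geq_max; apply/andP; split.
  apply: small; last by rewrite !coefE divfK ?subrr.
  rewrite (leq_trans (size_polyD _ _)) // size_polyN geq_max -sp sq /=.
  exact: size_scale_leq.
rewrite (leq_trans (size_sum _ _ _)) //; apply/bigmax_leqP_seq => x xs _.
by rewrite (leq_trans (size_scale_leq _ _)) // size_divp_XsubC sp.
Qed.

(** * Real polynomials over the complex numbers *)

Local Open Scope complex_scope.
Local Notation Re := complex.Re.
Local Notation Im := complex.Im.

Lemma root_toCpoly (R : realType) (p : {poly R}) (x : R) :
  root (toCpoly p) x%:C = root p x.
Proof. exact: fmorph_root. Qed.

Lemma simple_toCpoly (R : realType) (p : {poly R}) (x : R) :
  p != 0 -> root p x -> (mup x%:C (toCpoly p) == 1%N) = (p^`().[x] != 0).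
Proof.
move=> p0 px; rewrite simple_rootE ?root_toCpoly ?map_poly_eq0 //.
by rewrite /toCpoly deriv_map horner_map fmorph_eq0.
Qed.

Lemma real_simple_neq0 (R : realType) (p : {poly R}) : real_simple_roots p -> p != 0.
Proof.
move=> rs; apply/eqP => p0; have [|[x /eqP]] := rs 'i.
  by rewrite p0 /toCpoly rmorph0 root0.
by rewrite eq_complex /= oner_eq0 andbF.
Qed.

Lemma real_simple_deriv (R : realType) (p : {poly R}) (x : R) :
  real_simple_roots p -> root p x -> p^`().[x] != 0.
Proof.
move=> rs px; have p0 := real_simple_neq0 rs.
by rewrite -simple_toCpoly //; apply/eqP; apply: (rs _ _).2; rewrite root_toCpoly.
Qed.

(** Over [R[i]] the polynomial splits; simplicity makes the list of roots duplicate-free, and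
    reality lets each root be replaced by its real part. *)
Lemma real_simple_root_seq (R : realType) (p : {poly R}) : real_simple_roots p ->
  exists s : seq R, [/\ uniq s, size p = (size s).+1 & all (root p) s].
Proof.
move=> rs; have p0 := real_simple_neq0 rs.
have P0 : toCpoly p != 0 by rewrite map_poly_eq0.
have [r PE] := closed_field_poly_normal (toCpoly p).
have lc0 : lead_coef (toCpoly p) != 0 by rewrite lead_coef_eq0.
have rootE z : root (toCpoly p) z = (z \in r).
  by rewrite PE rootZ // root_prod_XsubC.
have ur : uniq r.
  apply: count_mem_uniq => z; have [zr|zr] := boolP (z \in r); last exact/count_memPn.
  rewrite -mu_prod_XsubC -(mupMr (q1 := (lead_coef (toCpoly p))%:P)) ?rootC //.
  by rewrite mul_polyC -PE (rs z _).2 ?rootE.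
have rE : r = [seq x%:C | x <- [seq Re z | z <- r]].
  rewrite -map_comp -[LHS]map_id; apply/eq_in_map => z zr /=.
  by have [[x ->] _] := rs z (etrans (rootE z) zr).
exists [seq Re z | z <- r]; split.
- by move: ur; rewrite {1}rE => /map_uniq.
- rewrite -(size_map_poly (real_complex R)) -/(toCpoly p) PE size_scale //.
  by rewrite size_prod_XsubC size_map.
- by apply/allP => x xr; rewrite -root_toCpoly rootE rE map_f.
Qed.

(** * From interlacing to roots in the upper half-plane *)

Lemma Im_inv_le0 (R : rcfType) (z : R[i]) (x : R) : Im z <= 0 ->
  0 <= Im (z - x%:C)^-1.
Proof.
case: z => a b /= b0; rewrite subr0 -mulNr divr_ge0 ?oppr_ge0 ?addr_ge0 ?sqr_ge0 //.
Qed.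

Lemma Im_sum (R : rcfType) (I : Type) (s : seq I) (F : I -> R[i]) :
  Im (\sum_(i <- s) F i) = \sum_(i <- s) Im (F i).
Proof. by apply: (big_morph (@complex.Im R)) => // -[a b] [c d]. Qed.

Lemma Im_realM (R : rcfType) (k : R) (z : R[i]) : Im (k%:C * z) = k * Im z.
Proof. by case: z => a b /=; rewrite mul0r addr0. Qed.

(* Half of the Hermite-Biehler theorem: all residues of q / p have the same
   sign, so z |-> Im (q / p) has a fixed sign on the closed lower half-plane,
   and the equation p + i s q = 0 amounts to q / p = i s. *)
Lemma interlace_upper_roots (R : realType) (p q : {poly R}) :
  real_simple_roots p -> (forall x, root q x -> q^`().[x] != 0) ->
  strictly_interlace p q -> (size q <= size p)%N ->
  exists2 s : R, s ^+ 2 = 1 & forall z : R[i], Im z <= 0 ->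
    (toCpoly p).[z] + 'i * s%:C * (toCpoly q).[z] != 0.
Proof.
move=> rp sq pq szq; have p0 := real_simple_neq0 rp.
have [S [uS szS rS]] := real_simple_root_seq rp.
have sp x : root p x -> p^`().[x] != 0 by exact: real_simple_deriv.
pose c x := q.[x] / p^`().[x].
have c_consec x y : consecutive_roots p x y -> 0 < c x * c y.
  exact: consecutive_residues.
have c_lt x y : x < y -> root p x -> root p y -> 0 < c x * c y.
  (* Having a positive product is transitive, since [c y ^+ 2] can be cancelled, so it passes from
     consecutive roots to any two. *)
  apply: (consecutive_roots_ind (r := fun x y => 0 < c x * c y)) => // {}x {}y z xy yz.
  have y2 : 0 < c y ^+ 2.
    by rewrite exprn_even_gt0 //=; apply: contraTneq xy => ->; rewrite mulr0 ltxx.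
  rewrite -(pmulr_rgt0 _ y2); suff -> : c y ^+ 2 * (c x * c z) = c x * c y * (c y * c z).
    exact: mulr_gt0.
  by ring.
have c_nz x : root p x -> c x != 0.
  move=> px; rewrite mulf_neq0 ?invr_eq0 ?sp //.
  by case: pq => + _ _; apply.
have [s s2 sc] : exists2 s, s ^+ 2 = 1 & forall x, x \in S -> s * c x < 0.
  case: {uS szS} S rS => [|x0 S rS]; first by exists 1; rewrite ?expr1n.
  have px0 : root p x0 by case/andP: rS.
  (* All residues share the sign of the one at [x0]; [s] is the opposite sign. *)
  exists (- Num.sg (c x0)); first by rewrite sqrrN sqr_sg c_nz.
  move=> x /(allP rS) px; rewrite mulNr oppr_lt0.
  have cc : 0 < c x0 * c x.
    case: (ltgtP x0 x) => [lt|lt|<-]; first exact: c_lt.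
      by rewrite mulrC; exact: c_lt.
    by rewrite -expr2 exprn_even_gt0 //= c_nz.
  have nx : 0 < `|c x0| by rewrite normr_gt0 c_nz.
  by rewrite -(pmulr_rgt0 _ nx) mulrA [`|_| * _]mulrC -numEsg.
exists s => // z zle; apply/eqP => eq0.
(* A root of [p] is real, and the equation would make it a root of [q] too, against interlacing. *)
have pz0 : (toCpoly p).[z] != 0.
  apply/eqP => pz; have [|[x zE] _] := rp z; first exact/rootP.
  move: eq0; rewrite pz add0r => /eqP; rewrite !mulf_eq0 => /orP[/orP[]|].
  - by rewrite eq_complex /= oner_eq0 andbF.
  - rewrite fmorph_eq0 => /eqP s0; move: s2; rewrite s0 expr0n /= => /eqP.
    by rewrite eq_sym oner_eq0.
  - rewrite -/(root _ _) zE root_toCpoly; apply/negP; case: pq => + _ _; apply.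
    by rewrite -root_toCpoly -zE; apply/rootP.
have [k qE] := partial_fractions uS szS rS szq.
have ratio : (toCpoly q).[z] / (toCpoly p).[z] =
    k%:C + \sum_(x <- S) (c x)%:C * (z - x%:C)^-1.
  rewrite {1}qE /toCpoly rmorphD /= map_polyZ rmorph_sum /= !hornerE horner_sum mulrDl.
  rewrite mulfK //; congr (_ + _); rewrite mulr_suml; apply: eq_big_seq => x xS.
  have zx : z - x%:C != 0.
    apply: contraNneq pz0 => /eqP; rewrite subr_eq0 => /eqP ->.
    by rewrite -/(root _ _) root_toCpoly (allP rS).
  rewrite map_polyZ hornerZ -mulrA; congr (_ * _).
  have {2}-> : p = p %/ ('X - x%:P) * ('X - x%:P).
    by rewrite divpK // dvdp_XsubCl (allP rS).
  rewrite rmorphM /= hornerM map_polyXsubC hornerXsubC invfM mulrA divff ?mul1r //.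
  apply: contraNneq pz0 => d0; rewrite /toCpoly -(divpK (_ : 'X - x%:P %| p)).
    by rewrite rmorphM hornerM /= d0 mul0r.
  by rewrite dvdp_XsubCl (allP rS).
(* Multiplying the equation by ['i * s%:C], whose square is -1, solves it for the ratio. *)
have : (toCpoly q).[z] / (toCpoly p).[z] = 'i * s%:C.
  apply: (mulIf pz0); rewrite divfK //.
  move/eqP: eq0; rewrite addr_eq0 => /eqP ->; rewrite mulrN mulrA.
  have -> : 'i * s%:C * ('i * s%:C) = -1 :> R[i].
    by rewrite mulrACA -!expr2 sqr_i -rmorphXn s2 mulr1.
  by rewrite mulN1r opprK.
(* After scaling by [s], the imaginary part of the right side is [s ^+ 2 = 1]; on the left the real
   [k] contributes nothing and every summand is at most 0. *)
rewrite ratio => /(congr1 (fun w => s * Im w)).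
rewrite raddfD /= add0r Im_sum mulr_sumr.
rewrite mul0r mul1r add0r -expr2 s2 => sum1.
have : (1 : R) <= 0; last by rewrite ler10.
rewrite -[X in X <= _]sum1 big_seq; apply: sumr_le0 => x xS.
by rewrite Im_realM mulrA mulr_le0_ge0 ?Im_inv_le0 // ltW ?sc.
Qed.

(** * Polynomials with all roots in the upper half-plane *)

Lemma normc_conj (R : rcfType) (z : R[i]) : `|z^*| = `|z|.
Proof. by case: z => a b; rewrite !normc_def /= sqrrN. Qed.

Lemma normc_lt (R : rcfType) (z w : R[i]) :
  Re z = Re w -> Im z ^+ 2 < Im w ^+ 2 -> `|z| < `|w|.
Proof.
move=> zw lt; rewrite !normc_def ltcR zw ltr_sqrt ?ltrD2l //.
by rewrite ltr_wpDl ?sqr_ge0 // (le_lt_trans _ lt) ?sqr_ge0.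
Qed.

Lemma upper_roots (R : rcfType) (F : {poly R[i]}) :
  (forall z, Im z <= 0 -> F.[z] != 0) ->
  exists r : seq R[i], [/\ lead_coef F != 0,
    F = lead_coef F *: \prod_(z <- r) ('X - z%:P) & forall z, z \in r -> 0 < Im z].
Proof.
move=> nz; have F0 : F != 0.
  by apply: contraNneq (nz 0 (lexx _)) => ->; rewrite horner0.
have [r FE] := closed_field_poly_normal F; exists r; rewrite lead_coef_eq0; split=> // z zr.
rewrite ltNge; apply/negP => /nz /negP; apply.
by rewrite -/(root F z) FE rootZ ?lead_coef_eq0 // root_prod_XsubC.
Qed.

(** The modulus of [F] is that of its leading coefficient times the product of the distances to the
    roots; [1 < size F] supplies a root, which makes the inequality strict. *)
Lemma upper_roots_norm_lt (R : rcfType) (F : {poly R[i]}) (z w : R[i]) :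
  (1 < size F)%N -> (forall z, Im z <= 0 -> F.[z] != 0) ->
  (forall u, 0 < Im u -> `|z - u| < `|w - u|) -> `|F.[z]| < `|F.[w]|.
Proof.
move=> szF /upper_roots[r [lc0 FE rP]] lt; rewrite FE !hornerZ !normrM.
rewrite ltr_pM2l ?normr_gt0 // !horner_prod !normr_prod big_seq [ltRHS]big_seq.
apply: ltr_prod => [|u /rP u0]; last by rewrite !hornerXsubC normr_ge0 lt.
case: r FE {rP} => [FE|u r _]; last by rewrite /= mem_head.
by move: szF; rewrite FE big_nil size_scale // size_poly1.
Qed.

(* Im (F' / F) > 0 on the real line, because F' / F is the sum of the
   1 / (x - z) over the roots z of F. *)
Lemma upper_roots_logderiv (R : rcfType) (F : {poly R[i]}) (x : R) :
  (1 < size F)%N -> (forall z, Im z <= 0 -> F.[z] != 0) ->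
  0 < Im (F^`().[x%:C] * F.[x%:C]^*).
Proof.
move=> szF /upper_roots[r [lc0 FE rP]].
have r0 : r != [::].
  by apply: contraTneq szF => r0; rewrite FE r0 big_nil size_scale // size_poly1.
(* Up to the squared modulus of [G] at [x], this is the imaginary part of G' / G; free of division,
   it satisfies [step] even where [G] vanishes. *)
pose I (G : {poly R[i]}) := Im (G^`().[x%:C] * G.[x%:C]^*).
have step (G : {poly R[i]}) (z : R[i]) :
    I (('X - z%:P) * G) = Im z * (Re G.[x%:C] ^+ 2 + Im G.[x%:C] ^+ 2)
      + ((x - Re z) ^+ 2 + Im z ^+ 2) * I G.
  rewrite /I derivM derivXsubC mul1r.
  rewrite !(hornerD, hornerM, hornerXsubC, hornerN, hornerX, hornerC).
  case: z G.[_] G^`().[_] => [a b] [c d] [e f] /=; ring.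
have IZ (k : R[i]) (G : {poly R[i]}) : I (k *: G) = (Re k ^+ 2 + Im k ^+ 2) * I G.
  rewrite /I derivZ !hornerZ; case: k G.[_] G^`().[_] => [a b] [c d] [e f] /=; ring.
have sq_gt0 (k : R[i]) : k != 0 -> 0 < Re k ^+ 2 + Im k ^+ 2.
  by move=> k0; rewrite -ltcR add_Re2_Im2 exprn_gt0 ?normr_gt0.
rewrite -/(I F) FE IZ mulr_gt0 ?sq_gt0 // {FE IZ}.
have I_ge0 (s : seq R[i]) : (forall z, z \in s -> 0 < Im z) ->
    0 <= I (\prod_(z <- s) ('X - z%:P)).
  elim: s => [|z s IH] sP; first by rewrite big_nil /I derivC horner0 mul0r.
  rewrite big_cons step addr_ge0 ?mulr_ge0 ?addr_ge0 ?sqr_ge0 ?(ltW (sP z _)) ?mem_head //.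
  by apply: IH => u us; apply: sP; rewrite inE us orbT.
(* The first root gives strict positivity, since the product over the others has no real zero. *)
case: r r0 rP => // z r _ rP; rewrite big_cons step ltr_pwDl //.
  rewrite mulr_gt0 ?rP ?mem_head // sq_gt0 // -/(root _ _) root_prod_XsubC.
  apply/negP => xr; have := rP x%:C; rewrite inE xr orbT => /(_ isT).
  by rewrite ltxx.
rewrite mulr_ge0 ?addr_ge0 ?sqr_ge0 // I_ge0 // => u ur.
by apply: rP; rewrite inE ur orbT.
Qed.

(** * From roots in the upper half-plane to self-interlacing *)

Lemma horner_toCpoly_conj (R : realType) (p : {poly R}) (z : R[i]) :
  (toCpoly p).[z^*] = (toCpoly p).[z]^*.
Proof.
rewrite -(horner_map (@conjc R)) /toCpoly -map_poly_comp; congr (_.[_]).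
by apply: eq_map_poly => x; rewrite /= oppr0.
Qed.

Lemma horner_toCpoly_oppX (R : realType) (p : {poly R}) (z : R[i]) :
  (toCpoly (p \Po - 'X)).[z] = (toCpoly p).[- z].
Proof.
by rewrite /toCpoly map_comp_poly rmorphN /= map_polyX horner_comp hornerN hornerX.
Qed.

(** The second summand has purely imaginary coefficients, so it cannot cancel the leading
    coefficient of [a]. *)
Lemma size_toCpoly_addi (R : realType) (a b : {poly R}) (s : R) :
  (size a <= size (toCpoly a + ('i * s%:C) *: toCpoly b)%R)%N.
Proof.
have [->|a0] := eqVneq a 0; first by rewrite size_poly0.
rewrite leqNgt; apply/negP => lt.
have : Re (toCpoly a + ('i * s%:C) *: toCpoly b)`_(size a).-1 = 0.
  by rewrite nth_default // -ltnS (leq_trans lt) ?leqSpred.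
rewrite coefD coefZ !coef_map /= !(mul0r, mulr0, subr0, addr0).
by apply/eqP; rewrite -[_ _.-1]/(lead_coef _) lead_coef_eq0.
Qed.

Lemma upper_roots_self_interlacing (R : realType) (q : {poly R}) (s : R) :
  s ^+ 2 = 1 ->
  (forall z : R[i], Im z <= 0 -> (toCpoly q).[z] - 'i * s%:C * (toCpoly q).[- z] != 0) ->
  self_interlacing q.
Proof.
move=> s2 nz; pose b := q \Po - 'X.
pose F := toCpoly q - ('i * s%:C) *: toCpoly b.
have FE z : F.[z] = (toCpoly q).[z] - 'i * s%:C * (toCpoly q).[- z].
  by rewrite /F hornerD hornerN hornerZ horner_toCpoly_oppX.
have Fnz z : Im z <= 0 -> F.[z] != 0 by rewrite FE; exact: nz.
have q0 : q != 0.
  apply: contraNneq (nz 0 (lexx _)) => ->.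
  by rewrite /toCpoly rmorph0 !horner0 mulr0 subrr.
(* Nonzero constants have no roots and are treated apart, because the estimates below require a
   nonconstant [F]. *)
have [sz|sz] := leqP (size q) 1.
  have [c c0 qE] : exists2 c, c != 0 & q = c%:P.
    by exists q`_0; [rewrite -polyC_eq0 -size1_polyC|exact: size1_polyC].
  have noroot x : ~~ root q x by rewrite qE rootC.
  split=> [z|].
    by rewrite /toCpoly qE map_polyC rootC fmorph_eq0 (negPf c0).
  split=> [x|x y [_ qx]|x y [_ ]].
  - by rewrite (negPf (noroot x)).
  - by move: qx; rewrite (negPf (noroot x)).
  - by rewrite qE comp_polyC rootC (negPf c0).
have szF : (1 < size F)%N.
  by rewrite (leq_trans sz) // /F -scaleNr -mulrN -rmorphN size_toCpoly_addi.
(* At a root [z] of [q], [F] has equal moduli at [z] and its conjugate, both that of [q] at [- z].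
   For [Im z < 0] the conjugate is closer to every root of [F], a contradiction. *)
have noroot_lower z : Im z < 0 -> ~~ root (toCpoly q) z.
  move=> z0; apply/negP => /rootP qz.
  have : `|F.[z^*]| < `|F.[z]|.
    apply: upper_roots_norm_lt => // u u0; apply: normc_lt.
      by case: z {qz} z0 u u0 => [? ?] ? [? ?].
    case: z {qz} z0 u u0 => [x y] /= y0 [v w] /= w0.
    rewrite -subr_gt0; have -> : (y - w) ^+ 2 - (- y - w) ^+ 2 = 4 * (- y * w) by ring.
    by rewrite !mulr_gt0 // oppr_gt0.
  rewrite !FE qz horner_toCpoly_conj qz conjc0 !add0r !normrN !normrM -rmorphN.
  by rewrite horner_toCpoly_conj normc_conj ltxx.
(* At a real [x], the imaginary part of F' times the conjugate of [F] is [s] times the Wronskian. *)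
have W x : 0 < s * (wronskian q b).[x].
  have := upper_roots_logderiv x szF Fnz.
  rewrite /F derivB derivZ !(hornerD, hornerN, hornerZ) /toCpoly !deriv_map !horner_map /=.
  congr (0 < _); rewrite /wronskian !(hornerD, hornerN, hornerM); ring.
have WW x y : 0 < (wronskian q b).[x] * (wronskian q b).[y].
  by have := mulr_gt0 (W x) (W y); rewrite mulrACA -expr2 s2 mul1r.
split; last exact: wronskian_interlace.
move=> z qz; have [x zE] : exists x : R, z = x%:C.
  exists (Re z); have : Im z = 0.
    case: (ltgtP (Im z) 0) => // [/noroot_lower|z0]; first by rewrite qz.
    have /noroot_lower : Im z^* < 0 by case: z {qz} z0 => ? ? /=; rewrite oppr_lt0.
    by rewrite rootE horner_toCpoly_conj (rootP qz) conjc0 eqxx.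
  by case: z {qz} => ? ? /= ->.
split; first by exists x.
move: qz; rewrite zE root_toCpoly => qx; apply/eqP; rewrite simple_toCpoly //.
apply: contraTneq (W x) => q'x.
by rewrite /wronskian !(hornerD, hornerN, hornerM) q'x (rootP qx) !mul0r subrr mulr0 ltxx.
Qed.

(** * The symmetric difference operator *)

Lemma Delta0_real (R : realType) (h : R) (p : {poly R}) :
  exists q, toCpoly q = Delta0 h p.
Proof.
pose D := Delta0 h p; exists (\poly_(i < size D) Re D`_i).
have conjP : map_poly (@conjc R) (toCpoly p) = toCpoly p.
  by rewrite /toCpoly -map_poly_comp; apply: eq_map_poly => x; rewrite /= oppr0.
have conj_ih : ('i * h%:C)^* = - ('i * h%:C).
  by apply/eqP; rewrite eq_complex /=; apply/andP; split; apply/eqP; ring.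
(* Conjugation exchanges the two shifts and negates the prefactor, so the two signs cancel. *)
have conjD : map_poly (@conjc R) D = D.
  rewrite /D /Delta0 -complexiE -mulrA; move: ('i * h%:C) conj_ih => w wE.
  have : ((2 * w)^-1)^* = - (2 * w)^-1.
    rewrite conjc_inv -invrN -mulrN -wE -[in RHS](conjc_nat R 2); congr (_^-1).
    exact: (rmorphM conjc).
  move: (2 * w)^-1 => k kE.
  rewrite map_polyZ rmorphB /= !map_comp_poly /= conjP.
  rewrite rmorphD rmorphB /= map_polyX map_polyC /= kE wE polyCN opprK.
  by rewrite scaleNr -scalerN opprB.
apply/polyP => i; rewrite coef_map coef_poly -/D; case: ltnP => [_|szi]; last first.
  by rewrite [RHS]nth_default.
have : (D`_i)^* = D`_i by rewrite -[in RHS]conjD coef_map.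
case: (D`_i) => a c /= [cE]; congr (_ +i* _); lra.
Qed.

Theorem theorem7p2 (R : realType) (p : {poly R}) (h : R) :
  0 < h -> (1 < size p)%N -> self_interlacing p ->
  exists q : {poly R}, toCpoly q = Delta0 h p /\ self_interlacing q.
Proof.
move=> h0 szp [rp pI]; have [q qE] := Delta0_real h p; exists q; split=> //.
pose b := p \Po - 'X.
have szb : size b = size p by rewrite size_comp_poly2 // size_polyN size_polyX.
have simple_b x : root b x -> b^`().[x] != 0.
  rewrite root_comp hornerN hornerX => /(real_simple_deriv rp).
  rewrite deriv_comp derivN derivX hornerM horner_comp !hornerN hornerX hornerC.
  by rewrite mulrN1 oppr_eq0.
have [s s2 nz] := interlace_upper_roots rp simple_b pI (eq_leq szb).
apply: (upper_roots_self_interlacing s2) => z zle.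
pose F := toCpoly p + ('i * s%:C) *: toCpoly b.
have FE w : F.[w] = (toCpoly p).[w] + 'i * s%:C * (toCpoly p).[- w].
  by rewrite /F hornerD hornerZ horner_toCpoly_oppX.
have Fnz w : Im w <= 0 -> F.[w] != 0.
  by move=> /nz; rewrite FE horner_toCpoly_oppX.
have szF : (1 < size F)%N := leq_trans szp (size_toCpoly_addi _ _ _).
have qz w : (toCpoly q).[w] = (2 * ('i * h%:C))^-1 *
    ((toCpoly p).[w + 'i * h%:C] - (toCpoly p).[w - 'i * h%:C]).
  by rewrite qE /Delta0 -complexiE -mulrA hornerZ hornerD hornerN !horner_comp !hornerE.
have d0 : (2 * ('i * h%:C))^-1 != 0 :> R[i].
  by rewrite invr_eq0 !mulf_neq0 ?pnatr_eq0 ?fmorph_eq0 ?(gt_eqF h0) ?neq0Ci.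
suff lt : `|F.[z + 'i * h%:C]| < `|F.[z - 'i * h%:C]|.
  (* Replacing [z] by [- z] exchanges the two shifts; this turns the plus sign in [F] into the minus
     sign of the goal, which becomes a nonzero multiple of the difference of the two values of
     [F]. *)
  rewrite !qz; have -> : forall k u v w t d : R[i],
      k * (u - v) - d * (k * (w - t)) = k * ((u + d * t) - (v + d * w)).
    by move=> *; ring.
  rewrite mulf_neq0 // subr_eq0; apply: contraTneq lt => eqF.
  by rewrite !FE !opprD opprK eqF ltxx.
(* Both points have the same real part, so only the imaginary distances to [u] matter; their squares
   differ by [4 * (h * (Im u - Im z))]. *)
apply: upper_roots_norm_lt => // u u0; apply: normc_lt.
  by case: z u {zle u0} => [? ?] [? ?] /=; ring.
case: z u zle u0 => [x y] [v w] /= y0 w0; rewrite mul0r add0r mul1r -subr_gt0.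
have -> : (y - h - w) ^+ 2 - (y + h - w) ^+ 2 = 4 * (h * (w - y)) by ring.
by rewrite !mulr_gt0 // subr_gt0 (le_lt_trans y0).
Qed.
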